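(* Let $K=\{4^m: m\ge 1\}\cup\{2\cdot p^m+2: p\in\{7,31,127\},\ m\ge 1\}$. There exists a $\mathrm{TOC}_3(n,3,3)$ for every $n\in K$.
   Context: $\mathcal{H}_q(n,w)$ is the set of all words of length $n$ over $\mathbb{Z}_q$ with exactly $w$ nonzero entries, with the Hamming distance. An $(n,d,w)_q$-code is a nonempty subset of $\mathcal{H}_q(n,w)$ in which any two distinct words have Hamming distance at least $d$; $A_q(n,d,w)$ is the maximum size of such a code and a code of this size is optimal. A $\mathrm{TOC}_q(n,d,w)$ is a partition of $\mathcal{H}_q(n,w)$ into mutually disjoint optimal $(n,d,w)_q$-codes. *)

(* Defs.v *)
From mathcomp Require Import all_boot.

(* Words of length n over Z_q, represented with the alphabet 'I_q = {0,...,q-1};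
   the zero symbol is the ordinal with value 0. *)
Definition word (q n : nat) := {ffun 'I_n -> 'I_q}.

Definition hwt (q n : nat) (x : word q n) : nat := #|[set i | val (x i) != 0]|.

Definition hdist (q n : nat) (x y : word q n) : nat := #|[set i | x i != y i]|.

Definition Hqnw (q n w : nat) : {set word q n} := [set x | hwt q n x == w].

Definition is_code (q n d w : nat) (C : {set word q n}) : bool :=
  [&& C != set0, C \subset Hqnw q n w &
      [forall x in C, forall y in C, (x != y) ==> (d <= hdist q n x y)]].

Definition Aq (q n d w : nat) : nat :=
  \max_(C : {set word q n} | is_code q n d w C) #|C|.

Definition optimal_code (q n d w : nat) (C : {set word q n}) : bool :=
  is_code q n d w C && (#|C| == Aq q n d w).

Definition TOC (q n d w : nat) (P : {set {set word q n}}) : bool :=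
  partition P (Hqnw q n w) && [forall C in P, optimal_code q n d w C].

Definition inK (n : nat) : Prop :=
  (exists m, 1 <= m /\ n = 4 ^ m) \/
  (exists p m, p \in [:: 7; 31; 127] /\ 1 <= m /\ n = 2 * p ^ m + 2).

(* Main.v *)
Require Import Defs.
From mathcomp Require Import all_boot all_order all_algebra zify.
Set Implicit Arguments. Unset Strict Implicit. Unset Printing Implicit Defensive.
Import GRing.Theory.

(** Deleting one letter maps the pairs (codeword, support point) of a code
    injectively into the words of weight 2, so an (n,3,3)_3-code has at most
    |H(2)|/3 words; and 3|H(3)| = 2(n-2)|H(2)|.  Hence a colouring of H(3) with
    2(n-2) colours that separates words at distance at most 2 has all its
    classes optimal, and it suffices to find such a colouring.

    All n in K have the form 2|G|+2, where G = (Z/(2^k-1))^m with k odd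
    (m = 1 gives the powers of 4).  Take the coordinates to be G x {0,1}
    together with two points at infinity, and the colours to be G x F_4, in the
    style of Schreiber and Wilson: three coordinates over distinct g, h, k get
    G-colour g+h+k, coordinates over g, g, h get 2g+h, and the quadruple
    {oo_0, oo_1, (g,0), (g,1)} is coloured in 3g by the solution for n = 4.  A
    triple {oo, (g,i), (h,j)} with g <> h can go to 2g+h or to g+2h; the choice
    is made by a function f on G with f(2x) = f(x) and f(-x) = ~ f(x), which
    exists because the order of 2 is odd, so that x and -x lie on different
    orbits of doubling.  The F_4-colours are affine in the signs. *)

(** * Counting bounds and the reduction to a colouring *)

Section Counting.
Variable n : nat.
Local Notation W3 := (word 3 n).
Local Notation H := (Hqnw 3 n).

Definition upd (x : W3) (i : 'I_n) (z : 'I_3) : W3 :=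
  [ffun j => if j == i then z else x j].

Definition supp (x : W3) := [set i | x i != ord0].

Lemma hwtE (x : W3) : hwt 3 n x = #|supp x|.
Proof. by apply: eq_card => i; rewrite !inE. Qed.

Lemma inH w (x : W3) : (x \in H w) = (#|supp x| == w).
Proof. by rewrite inE hwtE. Qed.

Lemma supp_upd0 (x : W3) i : supp (upd x i ord0) = supp x :\ i.
Proof. by apply/setP=> j; rewrite !inE ffunE; case: (j == i). Qed.

Lemma supp_upd (x : W3) i z : z != ord0 -> supp (upd x i z) = i |: supp x.
Proof. by move=> z0; apply/setP=> j; rewrite !inE ffunE; case: (j == i). Qed.

Lemma card_dep_pair (S T : finType) (A : {set S}) (B : S -> {set T}) m :
  (forall x, x \in A -> #|B x| = m) ->
  #|[set p : S * T | (p.1 \in A) && (p.2 \in B p.1)]| = #|A| * m.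
Proof.
move=> AB; rewrite -sum_nat_const.
transitivity (\sum_(x in A) \sum_(y in B x) 1).
  by rewrite pair_big_dep /= sum1dep_card.
by apply: eq_bigr => x xA; rewrite sum1_card AB.
Qed.

Lemma card_flags w (A : {set W3}) : A \subset H w ->
  #|[set p : W3 * 'I_n | (p.1 \in A) && (p.2 \in supp p.1)]| = #|A| * w.
Proof.
move=> /subsetP AH; apply: (card_dep_pair (B := supp)) => x /AH.
by rewrite inH => /eqP.
Qed.

Lemma card_code_le (C : {set W3}) : C \subset H 3 ->
  (forall x y, x \in C -> y \in C -> x != y -> 2 < hdist 3 n x y) ->
  #|C| * 3 <= #|H 2|.
Proof.
move=> CH dC; rewrite -(card_flags CH) -(card_in_imset (f := fun p => upd p.1 p.2 ord0)).
  apply: subset_leq_card; apply/subsetP=> _ /imsetP[[x i] /[!inE]/= /andP[xC xi] ->].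
  move/subsetP/(_ _ xC): CH; rewrite hwtE supp_upd0 inH (cardsD1 i) !inE xi.
  by rewrite add1n eqSS.
move=> [x i] [y j] /[!inE]/= /andP[xC xi] /andP[yC yj] /ffunP E.
(* Equal images make x and y agree outside {i, j}, hence lie at distance at most 2. *)
have xy : x = y.
  apply/eqP; apply: contraT => /(dC _ _ xC yC); rewrite ltnNge.
  suff /subset_leq_card le_xy : [set k | x k != y k] \subset [set i; j].
    by rewrite (leq_trans le_xy) // cards2; case: (i != j).
  apply/subsetP=> k; rewrite !inE; apply: contraR; rewrite negb_or => /andP[ki kj].
  by have:= E k; rewrite !ffunE (negPf ki) (negPf kj) => ->.
congr (_, _) => //; apply/eqP; apply: contraT => ij.
by have:= E i; rewrite !ffunE eqxx (negPf ij) -xy => xi0; rewrite -xi0 eqxx in xi.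
Qed.

(** Writing a nonzero letter at one of the n-2 zero positions of a weight-2 word gives a weight-3
    word with a marked support point; erasing the marked letter recovers the choice. *)
Lemma card_H2_H3 : #|H 2| * (2 * (n - 2)) <= #|H 3| * 3.
Proof.
rewrite -(card_flags (subxx _)).
pose B (x : W3) := setX (~: supp x) [set~ (ord0 : 'I_3)].
rewrite -(card_dep_pair (B := B)); last first.
  move=> x /[!inH] /eqP x2.
  by rewrite cardsX cardsCs setCK x2 card_ord cardsC1 card_ord mulnC.
rewrite -(card_in_imset (f := fun p => (upd p.1 p.2.1 p.2.2, p.2.1))).
  apply: subset_leq_card; apply/subsetP=> _ /imsetP[[x [i z]] + ->].
  rewrite in_set /= inH => /andP[/eqP xH]; rewrite in_setX /= in_setC in_setC1.
  move=> /andP[xi z0]; rewrite inE /= inH supp_upd // cardsU1 xi xH.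
  by rewrite !inE eqxx.
move=> [x [i z]] [y [j t]]; rewrite !inE /= !negbK.
move=> /andP[_ /andP[/eqP xi _]] /andP[_ /andP[/eqP yj _]] [/ffunP E ij].
rewrite -{j}ij in E yj *.
have <- : z = t by have:= E i; rewrite !ffunE eqxx.
congr (_, _); apply/ffunP=> k; have:= E k; rewrite !ffunE.
by case: eqP => // -> _; rewrite xi yj.
Qed.

Lemma card_H2_gt0 : 2 <= n -> 0 < #|H 2|.
Proof.
case: n => [|[|m]] // _; apply/card_gt0P.
exists [ffun j : 'I_m.+2 => if j < 2 then lift ord0 ord0 else ord0 : 'I_3].
rewrite inE /hwt -[X in _ == X](_ : #|[set (ord0 : 'I_m.+2); lift ord0 ord0]| = 2).
  by apply/eqP/eq_card=> j; rewrite !inE ffunE -!val_eqE /=; case: j => [[|[|j]]].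
by rewrite cards2.
Qed.

Lemma TOC_of_colouring (K : finType) (c : W3 -> K) :
  2 <= n -> #|K| = 2 * (n - 2) ->
  {in H 3 &, forall x y, x != y -> hdist 3 n x y <= 2 -> c x != c y} ->
  exists P, TOC 3 n 3 3 P.
Proof.
move=> n2 cK cP.
pose D k := [set x in H 3 | c x == k].
have DH k : D k \subset H 3 by apply/subsetP=> x; rewrite !inE => /andP[].
have Dcode k x y : x \in D k -> y \in D k -> x != y -> 2 < hdist 3 n x y.
  rewrite ![_ \in D _]inE => /andP[xH /eqP xk] /andP[yH /eqP yk] xy.
  by rewrite ltnNge; apply/negP=> /(cP _ _ xH yH xy); rewrite xk yk eqxx.
have Dle k : #|D k| * 3 <= #|H 2| by apply: card_code_le (DH k) (@Dcode k).
have sumD : \sum_k #|D k| = #|H 3|.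
  rewrite -sum1_card (partition_big c predT) //=; apply: eq_bigr => k _.
  by rewrite -sum1_card; apply: eq_bigl => x; rewrite inE.
have DE k : #|D k| * 3 = #|H 2|.
  (* No class exceeds the bound, and by [card_H2_H3] the deficits sum to zero, so every class
     attains it. *)
  have : (\sum_k (#|H 2| - #|D k| * 3) == 0)%N.
    rewrite sumnB // sum_nat_const -big_distrl /= sumD subn_eq0.
    by rewrite -[#|xpredT|]/#|K| cK mulnC card_H2_H3.
  by rewrite sum_nat_eq0 => /forallP/(_ k); rewrite subn_eq0 => leD;
    apply/eqP; rewrite eqn_leq Dle.
have codeD k : is_code 3 n 3 3 (D k).
  apply/and3P; split=> //.
    by rewrite -card_gt0 -(ltn_pmul2r (m := 3)) // DE card_H2_gt0.
  apply/forall_inP=> x xD; apply/forall_inP=> y yD; apply/implyP; exact: Dcode xD yD.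
have optD k : optimal_code 3 n 3 3 (D k).
  rewrite /optimal_code codeD eqn_leq /Aq (leq_bigmax_cond (D k)) //=.
  apply/bigmax_leqP=> C /and3P[_ CH /forall_inP dC].
  rewrite -(leq_pmul2r (m := 3)) // DE; apply: card_code_le => // x y xC yC xy.
  by move/forall_inP/(_ y yC)/implyP: (dC x xC); apply.
exists (preim_partition c (H 3)); rewrite /TOC preim_partitionP /=.
apply/forall_inP=> C /imsetP[x xH ->].
suff -> : [set y in H 3 | c x == c y] = D (c x) by [].
by apply/setP=> y; rewrite !inE [c y == _]eq_sym.
Qed.

End Counting.

(** * The F_4-colours and their finite checks *)

Local Notation F4 := (bool * bool)%type.
Definition add4 (u v : F4) : F4 := (u.1 (+) v.1, u.2 (+) v.2).
Local Infix "+4" := add4 (at level 50, left associativity).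
Definition scale4 (b : bool) (v : F4) : F4 := if b then v else (false, false).
Local Infix "*4" := scale4 (at level 40).

(* Multiplication by a primitive element of F_4. *)
Definition mulw (u : F4) : F4 := (u.2, u.1 (+) u.2).

Lemma add4A : associative add4.
Proof. by move=> [[] []] [[] []] [[] []]. Qed.

Lemma add4C : commutative add4.
Proof. by move=> [[] []] [[] []]. Qed.

Lemma add4I u : injective (add4 u).
Proof. by case: u => [[] []] [[] []] [[] []]. Qed.

(* The colouring for n = 4, with coordinates labelled by F_4: the linear part is
   the determinant of the rows (1, a, x), (1, b, y), (1, c, z). *)
Definition centre (a : F4) x b y c z : F4 :=
  x *4 (b +4 c) +4 y *4 (a +4 c) +4 z *4 (a +4 b) +4 mulw (a +4 b +4 c).

Lemma centreC a x b y c z : centre a x b y c z = centre b y a x c z.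
Proof. by rewrite /centre (add4C b a) (add4C (x *4 _)). Qed.

Lemma centreCr a x b y c z : centre a x b y c z = centre a x c z b y.
Proof.
by case: a b c x y z => [[] []] [[] []] [[] []] [] [] [].
Qed.

(** If c = c', changing z adds a+b. Otherwise c+c' = a+b, and the colours differ by w(a+b) plus 0 or
    a+b, where w is the primitive element; this is never zero. *)
Lemma centre_inj a x b y c z c' z' :
  centre a x b y c z = centre a x b y c' z' ->
  a != b -> a != c -> b != c -> a != c' -> b != c' -> (c, z) = (c', z').
Proof.
move=> + ab ac bc ac' bc'; move: ab; case: a b ac bc ac' bc' => [[] []] [[] []] + + + + //;
case: c => [[] []] // _ _; case: c' => [[] []] // _ _ _;
by case: x y z z' => [] [] [] [].
Qed.

(** The two flips add (b+c) + (a+c) = a+b, which is nonzero. *)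
Lemma centre_flip a x b y c z :
  a != b -> a != c -> b != c ->
  centre a x b y c z <> centre a (~~ x) b (~~ y) c z.
Proof.
case: a b => [[] []] [[] []] // _; case: c => [[] []] // _ _;
by case: x y z => [] [] [].
Qed.

(** [vec_p false], [vec_p true] and [vec_q] are the three nonzero elements of F_4; each is the sum
    of the other two. *)
Definition vec_p (i : bool) : F4 := (~~ i, i).
Definition vec_q : F4 := (true, true).

(* F_4-colours inside the G-colour 2g+h, where e = f(h-g): [edgeA] is for the
   triple (g,i), (g,i'), (h,j) with signs x, x', y, and [edgeB] for oo, (g,i),
   (h,j) with signs z, x, y.  The coefficients of the signs are forced by the
   requirement that the two kinds of triples on a signed pair (g,i), (h,j) use
   complementary halves of F_4.  The constants [edge_const] then solve a system
   of disequations linking the edges g -> -2g of types e and ~~ e. *)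
Definition edgeA (e j i x i' x' y : bool) : F4 :=
  x *4 vec_p i +4 x' *4 vec_p i' +4 y *4 vec_q +4 j *4 vec_p e.

Definition edge_const (e i j : bool) : F4 :=
  match e, i, j with
  | false, false, false => (true, false)
  | false, false, true => (false, false)
  | false, true, _ => (false, true)
  | true, true, true => (true, false)
  | true, _, _ => (true, true)
  end.

Definition edgeB (e i j z x y : bool) : F4 :=
  z *4 vec_p (~~ i) +4 x *4 (if i == j then vec_p i else vec_q)
  +4 y *4 (if i == j then vec_q else vec_p i) +4 edge_const e i j.

(** With e = f(h-g), true sends {oo_b, (g,i), (h,j)} to 2g+h and false to g+2h. Swapping the ends
    negates e, hence the value; given e, any two of i, j, b determine the third. *)
Definition orient (e i j b : bool) := e (+) i (+) j (+) b.

Lemma edgeAC e j i x i' x' y : edgeA e j i x i' x' y = edgeA e j i' x' i x y.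
Proof. by rewrite /edgeA (add4C (x *4 _)). Qed.

(** The coefficients [vec_p e] of j and [vec_q] of y are linearly independent. *)
Lemma edgeA_inj_h e i x x' j y j' y' :
  edgeA e j i x (~~ i) x' y = edgeA e j' i x (~~ i) x' y' -> (j, y) = (j', y').
Proof. by case: e i x x' j y j' y' => [] [] [] [] [] [] [] []. Qed.

Lemma edgeA_inj_g e j i i' x x1 x2 y :
  edgeA e j i x i' x1 y = edgeA e j i x i' x2 y -> x1 = x2.
Proof. by case: e i i' x j y x1 x2 => [] [] [] [] [] [] [] []. Qed.

Lemma edgeB_inj_inf e i j z x y z' :
  edgeB e i j z x y = edgeB e i j z' x y -> z = z'.
Proof. by case: e i j z x y z' => [] [] [] [] [] [] []. Qed.

(** Modulo [vec_p (~~ i)], which absorbs x' and z, the vectors [vec_p i] and [vec_q] coincide, so x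
    and y cancel. The constants still differ in this quotient. *)
Lemma edgeA_edgeB e i j x x' y z : edgeA e j i x (~~ i) x' y <> edgeB e i j z x y.
Proof. by case: e i j x x' y z => [] [] [] [] [] [] []. Qed.

Lemma edgeB_inj_out e i j y j' y' b z x : orient e i j b -> orient e i j' b ->
  edgeB e i j z x y = edgeB e i j' z x y' -> (j, y) = (j', y').
Proof. by case: e i j y j' y' b z x => [] [] [] [] [] [] [] [] []. Qed.

Lemma edgeB_inj_in e i j x i' x' b z y : orient e i j b -> orient e i' j b ->
  edgeB e i j z x y = edgeB e i' j z x' y -> (i, x) = (i', x').
Proof. by case: e i j y i' x' b z x => [] [] [] [] [] [] [] [] []. Qed.

(** The orientations force k = ~~ j, so y and x' have the same coefficient: [vec_q] if i = j,
    [vec_p i] otherwise. Modulo that vector z and x cancel, and the values of [edge_const]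
    differ. *)
Lemma edgeB_in_out e i j x y k x' b z : orient e i j b -> orient (~~ e) k i b ->
  edgeB e i j z x y <> edgeB (~~ e) k i z x' x.
Proof. by case: e i j y k x' b z x => [] [] [] [] [] [] [] [] []. Qed.

(** Here and in the next four lemmas, the two flipped signs have distinct coefficients, whose sum is
    therefore nonzero. *)
Lemma edgeA_flip1 e j i x x' y :
  edgeA e j i x (~~ i) x' y <> edgeA e j i (~~ x) (~~ i) (~~ x') y.
Proof. by case: e j i x x' y => [] [] [] [] [] []. Qed.

Lemma edgeA_flip2 e j i x x' i' y :
  edgeA e j i x i' x' y <> edgeA e j i (~~ x) i' x' (~~ y).
Proof. by case: e j i i' x x' y => [] [] [] [] [] [] []. Qed.

Lemma edgeB_flip1 e i j z x y : edgeB e i j z x y <> edgeB e i j z (~~ x) (~~ y).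
Proof. by case: e j i z x y => [] [] [] [] [] []. Qed.

Lemma edgeB_flip2 e i j z x y : edgeB e i j z x y <> edgeB e i j (~~ z) x (~~ y).
Proof. by case: e j i z x y => [] [] [] [] [] []. Qed.

Lemma edgeB_flip3 e i j z x y : edgeB e i j z x y <> edgeB e i j (~~ z) (~~ x) y.
Proof. by case: e j i z x y => [] [] [] [] [] []. Qed.

(* The exponents of the primitive element are the ranks of g, h, k among
   themselves: any three distinct nonzero coefficients would do. *)
Definition mulw_rank (s t : bool) (u : F4) : F4 := iter (s + t) mulw u.
Definition generic (gh gk hk : bool) (u v w : F4) : F4 :=
  mulw_rank (~~ gh) (~~ gk) u +4 mulw_rank gh (~~ hk) v +4 mulw_rank gk hk w.

Lemma genericC gh gk hk u v w : generic gh gk hk u v w = generic (~~ gh) hk gk v u w.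
Proof.
by rewrite /generic negbK [mulw_rank _ _ u +4 _]add4C /mulw_rank (addnC gk).
Qed.

Lemma genericCr gh gk hk u v w : generic gh gk hk u v w = generic gk gh (~~ hk) u w v.
Proof.
by rewrite /generic negbK -!add4A (add4C (mulw_rank gk hk w)) /mulw_rank (addnC (~~ gk)).
Qed.

Lemma generic_inj gh gk hk u v w w' :
  generic gh gk hk u v w = generic gh gk hk u v w' -> w = w'.
Proof.
move=> /add4I; rewrite /mulw_rank.
by case: gk hk w w' => [] [] [[] []] [[] []].
Qed.

(** The hypotheses exclude the two cyclic comparison patterns, so the ranks differ, and the flips
    add one nonzero vector multiplied by two different powers of the primitive element. *)
Lemma generic_flip (gh gk hk i x j y : bool) (w : F4) :
  (gh -> hk -> gk) -> (gk -> gh || hk) ->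
  generic gh gk hk (i, x) (j, y) w <> generic gh gk hk (i, ~~ x) (j, ~~ y) w.
Proof.
rewrite /generic => h1 h2; rewrite ![_ +4 mulw_rank gk hk w]add4C => /add4I.
case: gh gk hk h1 h2 => [] [] [] h1 h2; try by [move: (h1 isT isT)|move: (h2 isT)];
by case: i x j y => [] [] [] [].
Qed.

(** * Colouring triples of signed points *)

Section Colouring.
Local Open Scope ring_scope.
Variables (G : finZmodType) (f : G -> bool).
Hypothesis dbl_eq0 : forall x : G, x + x = 0 -> x = 0.
Hypothesis tpl_eq0 : forall x : G, x + x + x = 0 -> x = 0.
Hypothesis f_dbl : forall x : G, f (x + x) = f x.
Hypothesis f_opp : forall x : G, x != 0 -> f (- x) = ~~ f x.

Implicit Types (g h k : G) (b i j l x y z w : bool).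

(* [inl b] is the point oo_b at infinity. *)
Definition gpoint := (bool + G * bool)%type.
Definition spoint := (gpoint * bool)%type.

Definition rank_lt (g h : G) := (enum_rank g < enum_rank h)%N.

(** The numeral in [colour_inf0], [colour_inf1], [colour_inf2] counts the points at infinity. In
    [centre], oo_b is labelled (false, b) and (g,i) is labelled (true, i). *)
Definition colour_inf1 (b z : bool) (g : G) (i x : bool) (h : G) (j y : bool) : G * F4 :=
  if g == h then (g + g + g, centre (false, b) z (true, i) x (true, j) y)
  else if orient (f (h - g)) i j b then (g + g + h, edgeB (f (h - g)) i j z x y)
  else (h + h + g, edgeB (f (g - h)) j i z y x).

Definition colour_inf0 (g : G) (i x : bool) (h : G) (j y : bool) (k : G) (l z : bool) :
    G * F4 :=
  (g + h + k,
   if g == h then edgeA (f (k - g)) l i x j y z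
   else if g == k then edgeA (f (h - g)) j i x l z y
   else if h == k then edgeA (f (g - h)) i j y l z x
   else generic (rank_lt g h) (rank_lt g k) (rank_lt h k) (i, x) (j, y) (l, z)).

Definition colour_inf2 (b z b' z' : bool) (g : G) (i x : bool) : G * F4 :=
  (g + g + g, centre (false, b) z (false, b') z' (true, i) x).

(** The default is reached only by three points at infinity, which cannot be distinct. *)
Definition triple_colour (P Q R : spoint) : G * F4 :=
  match P, Q, R with
  | (inl b, z), (inl b', z'), (inr (g, i), x)
  | (inl b, z), (inr (g, i), x), (inl b', z')
  | (inr (g, i), x), (inl b, z), (inl b', z') => colour_inf2 b z b' z' g i x
  | (inl b, z), (inr (g, i), x), (inr (h, j), y)
  | (inr (g, i), x), (inl b, z), (inr (h, j), y)
  | (inr (g, i), x), (inr (h, j), y), (inl b, z) => colour_inf1 b z g i x h j y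
  | (inr (g, i), x), (inr (h, j), y), (inr (k, l), z) => colour_inf0 g i x h j y k l z
  | _, _, _ => (0, (false, false))
  end.

Lemma dbl_inj (x y : G) : x + x = y + y -> x = y.
Proof.
move=> /eqP; rewrite -subr_eq0 opprD addrACA => /eqP/dbl_eq0/eqP.
by rewrite subr_eq0 => /eqP.
Qed.

Lemma tpl_inj (x y : G) : x + x + x = y + y + y -> x = y.
Proof.
move=> /eqP; rewrite -subr_eq0 !opprD addrACA (addrACA x) => /eqP/tpl_eq0/eqP.
by rewrite subr_eq0 => /eqP.
Qed.

Lemma tpl_dbl_inj (g h : G) : g + g + g = h + h + g -> g = h.
Proof. by move/addIr/dbl_inj. Qed.

Lemma f_subC (g h : G) : g != h -> f (g - h) = ~~ f (h - g).
Proof. by move=> gh; rewrite -f_opp ?opprB // subr_eq0 eq_sym. Qed.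

(** The hypothesis amounts to h-g = 2(k-g). *)
Lemma f_edge (g h k : G) : g + g + h = k + k + g -> f (h - g) = f (k - g).
Proof.
move=> E; rewrite -[RHS]f_dbl; congr f.
have E' : h + g = k + k by apply: (addIr g); rewrite -E -addrA addrC.
by rewrite addrACA -E' addrA addrK.
Qed.

Lemma rank_ltC (g h : G) : g != h -> rank_lt h g = ~~ rank_lt g h.
Proof.
move=> gh; rewrite /rank_lt -leqNgt ltn_neqAle (inj_eq val_inj) (inj_eq enum_rank_inj).
by rewrite eq_sym gh.
Qed.

Lemma colour_inf1C b z g i x h j y :
  colour_inf1 b z g i x h j y = colour_inf1 b z h j y g i x.
Proof.
rewrite /colour_inf1 eq_sym; case: eqVneq => [-> | hg]; first by rewrite centreCr.
rewrite (f_subC hg) /orient.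
by case: (f _) i j b => [] [] [] [].
Qed.

Lemma colour_inf2C b z b' z' g i x :
  colour_inf2 b z b' z' g i x = colour_inf2 b' z' b z g i x.
Proof. by rewrite /colour_inf2 centreC. Qed.

Lemma colour_inf0C g i x h j y k l z :
  colour_inf0 g i x h j y k l z = colour_inf0 h j y g i x k l z.
Proof.
rewrite /colour_inf0 (addrC g); congr (_, _); rewrite [h == g]eq_sym.
case: (eqVneq g h) => [-> | gh]; first by rewrite edgeAC.
case: (eqVneq g k) => [<- | gk]; first by rewrite eq_sym (negPf gh).
by case: (eqVneq h k) => // hk; rewrite genericC (rank_ltC gh).
Qed.

Lemma colour_inf0Cr g i x h j y k l z :
  (g, i) != (h, j) -> (g, i) != (k, l) -> (h, j) != (k, l) ->
  colour_inf0 g i x h j y k l z = colour_inf0 g i x k l z h j y.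
Proof.
rewrite /colour_inf0 addrAC => ij il jl; congr (_, _); rewrite [k == h]eq_sym.
case: (eqVneq g h) ij il jl => [-> | gh]; case: (eqVneq _ k) => [-> | gk] //.
  by rewrite !xpair_eqE eqxx; case: i j l => [] [] [].
case: (eqVneq h k) => [-> | hk] _ _ _; first by rewrite edgeAC.
by rewrite genericCr (rank_ltC hk).
Qed.

Lemma triple_colourC P Q R : triple_colour P Q R = triple_colour Q P R.
Proof.
case: P Q R => [[b|[g i]] x] [[b'|[g' i']] x'] [[b''|[g'' i'']] x''] //=.
- exact: colour_inf2C.
- exact: colour_inf1C.
- exact: colour_inf0C.
Qed.

Lemma triple_colourCr P Q R : P.1 != Q.1 -> P.1 != R.1 -> Q.1 != R.1 ->
  triple_colour P Q R = triple_colour P R Q.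
Proof.
case: P Q R => [[b|[g i]] x] [[b'|[g' i']] x'] [[b''|[g'' i'']] x''] //= n1 n2 n3.
- exact: colour_inf1C.
- exact: colour_inf2C.
- exact: colour_inf0Cr.
Qed.

Lemma orientC g h i j b : g != h ->
  orient (f (g - h)) j i b = ~~ orient (f (h - g)) i j b.
Proof. by move=> gh; rewrite f_subC // /orient; case: (f _) i j b => [] [] [] []. Qed.

Lemma colour_inf1_out b z g i x h j y : g != h -> orient (f (h - g)) i j b ->
  colour_inf1 b z g i x h j y = (g + g + h, edgeB (f (h - g)) i j z x y).
Proof. by rewrite /colour_inf1 => /negPf-> ->. Qed.

Lemma colour_inf1_in b z g i x h j y : g != h -> ~~ orient (f (h - g)) i j b ->
  colour_inf1 b z g i x h j y = (h + h + g, edgeB (f (g - h)) j i z y x).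
Proof. by rewrite /colour_inf1 => /negPf-> /negPf->. Qed.

Lemma edge_block_inj (g h : G) : g + g + h = h + h + g -> g = h.
Proof. by rewrite addrAC [h + h + g]addrC addrA => /addrI. Qed.

Lemma neq_pair (g : G) (i j : bool) : (g, i) != (g, j) -> i != j.
Proof. by rewrite xpair_eqE eqxx. Qed.

Lemma neq_pairb (g : G) i j : (g, i) != (g, j) -> j = ~~ i.
Proof. by move/neq_pair; case: i j => [] []. Qed.

Lemma colour_inf2_inj b z b' z' g i x g' i' x' : b != b' ->
  colour_inf2 b z b' z' g i x = colour_inf2 b z b' z' g' i' x' -> (g, i, x) = (g', i', x').
Proof.
move=> bb' /pair_equal_spec[/tpl_inj<- E].
by have [-> ->] := centre_inj E bb' isT isT isT isT.
Qed.

Lemma colour_inf2_inj_inf b z b1 z1 b2 z2 g i x : b != b1 -> b != b2 ->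
  colour_inf2 b z b1 z1 g i x = colour_inf2 b z b2 z2 g i x -> (b1, z1) = (b2, z2).
Proof.
move=> bb1 bb2 /pair_equal_spec[_]; rewrite !(centreCr _ _ (false, _)) => E.
by have [-> ->] := centre_inj E isT bb1 isT bb2 isT.
Qed.

Lemma colour_inf1_noncentral b z g i x h j y : g != h ->
  g + g + g <> (colour_inf1 b z g i x h j y).1.
Proof.
move=> gh; have [o|o] := boolP (orient (f (h - g)) i j b).
  by rewrite colour_inf1_out // => /addrI/eqP; rewrite (negPf gh).
by rewrite colour_inf1_in // => /tpl_dbl_inj/eqP; rewrite (negPf gh).
Qed.

Lemma colour_inf2_inf1 b z b' z' g i x h j y : b != b' -> (g, i) != (h, j) ->
  colour_inf2 b z b' z' g i x <> colour_inf1 b z g i x h j y.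
Proof.
move=> bb'; case: (eqVneq g h) => [<-|gh] ij; last first.
  by move/(congr1 fst)/colour_inf1_noncentral; apply.
rewrite /colour_inf1 eqxx /colour_inf2 (centreCr _ _ (false, _)) => /pair_equal_spec[_ E].
by have := centre_inj E isT bb' isT isT (neq_pair ij).
Qed.

Lemma colour_inf1_inj b z g i x h j y h' j' y' : (g, i) != (h, j) -> (g, i) != (h', j') ->
  colour_inf1 b z g i x h j y = colour_inf1 b z g i x h' j' y' -> (h, j, y) = (h', j', y').
Proof.
case: (eqVneq g h) => [<-|gh] ij; case: (eqVneq g h') => [<-|gh'] ij'.
- rewrite /colour_inf1 eqxx => /pair_equal_spec[_ E].
  by have [-> ->] := centre_inj E isT isT (neq_pair ij) isT (neq_pair ij').
- by rewrite {1}/colour_inf1 eqxx => /(congr1 fst)/colour_inf1_noncentral; case.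
- by rewrite [RHS]/colour_inf1 eqxx => /esym/(congr1 fst)/colour_inf1_noncentral; case.
have [o|o] := boolP (orient (f (h - g)) i j b);
have [o'|o'] := boolP (orient (f (h' - g)) i j' b).
- rewrite !colour_inf1_out // => /pair_equal_spec[/addrI E]; rewrite -{h' gh' ij'}E in o' *.
  by move=> /(edgeB_inj_out o o')[-> ->].
(* Here 2g+h = 2h'+g: the edge g -> h leaves g and h' -> g enters it, and by [f_edge] their types
   are opposite. *)
- rewrite colour_inf1_out // colour_inf1_in // => /pair_equal_spec[/f_edge E].
  rewrite (f_subC gh') -E => /edgeB_in_out H; case: (H b o).
  by rewrite E -(f_subC gh') orientC.
- rewrite colour_inf1_in // colour_inf1_out // => /esym/pair_equal_spec[/f_edge E].
  rewrite (f_subC gh) -E => /edgeB_in_out H; case: (H b o').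
  by rewrite E -(f_subC gh) orientC.
- rewrite !colour_inf1_in // => /pair_equal_spec[/addIr/dbl_inj E].
  rewrite -{h' gh' ij'}E in o' *.
  rewrite -!orientC // in o o'.
  by move=> /(edgeB_inj_in o o')[-> ->].
Qed.

Lemma colour_inf1_inj_inf b z b' z' g i x h j y : (g, i) != (h, j) ->
  colour_inf1 b z g i x h j y = colour_inf1 b' z' g i x h j y -> (b, z) = (b', z').
Proof.
case: (eqVneq g h) => [<-|gh] ij.
  rewrite /colour_inf1 eqxx ![centre (false, _) _ _ _ _ _]centreC => /pair_equal_spec[_].
  rewrite ![centre _ _ (false, _) _ _ _]centreCr => E.
  by have [-> ->] := centre_inj E (neq_pair ij) isT isT isT isT.
have [o|o] := boolP (orient (f (h - g)) i j b);
have [o'|o'] := boolP (orient (f (h - g)) i j b').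
- rewrite !colour_inf1_out // => /pair_equal_spec[_] /edgeB_inj_inf->.
  by move: o o'; rewrite /orient; case: (f _) i j b b' {ij} => [] [] [] [] [].
- rewrite (colour_inf1_out _ _ _ gh o) (colour_inf1_in _ _ _ gh o').
  move=> /pair_equal_spec[/edge_block_inj E].
  by rewrite E eqxx in gh.
- rewrite (colour_inf1_out _ _ _ gh o') (colour_inf1_in _ _ _ gh o).
  move=> /pair_equal_spec[/esym/edge_block_inj E].
  by rewrite E eqxx in gh.
- rewrite !colour_inf1_in // => /pair_equal_spec[_] /edgeB_inj_inf->.
  by move: o o'; rewrite /orient; case: (f _) i j b b' {ij} => [] [] [] [] [].
Qed.

Lemma colour_inf1_inf0 b z g i x h j y k l w :
  (g, i) != (h, j) -> (g, i) != (k, l) -> (h, j) != (k, l) ->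
  colour_inf1 b z g i x h j y <> colour_inf0 g i x h j y k l w.
Proof.
(* By symmetry the triple at infinity goes to 2g+h, or to 3g if g = h. Equal G-colours then force k
   = g; for g = h this would put three distinct points over g. *)
wlog: g i x h j y / (g != h) ==> orient (f (h - g)) i j b => [W|o] ij il jl.
  have [ok|] := boolP ((g != h) ==> orient (f (h - g)) i j b); first exact: W.
  rewrite negb_imply => /andP[gh o]; rewrite colour_inf1C colour_inf0C.
  apply: W => //; last by rewrite eq_sym.
  by rewrite eq_sym gh orientC.
case: (eqVneq g h) o ij il jl => [<-|gh] /=.
  rewrite /colour_inf1 /colour_inf0 eqxx => _ ij il jl /pair_equal_spec[/addrI E _].
  move: ij il jl; rewrite -E => /neq_pair + /neq_pair + /neq_pair.
  by case: (i) (j) (l) => [] [] [].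
move=> o _ il _; rewrite colour_inf1_out // /colour_inf0 (negPf gh) => /pair_equal_spec[E].
have {E} gk : g = k by apply: (addrI (g + h)); rewrite -E addrAC.
rewrite -{k}gk in il *; rewrite eqxx (neq_pairb il) => /esym.
exact: edgeA_edgeB.
Qed.

Lemma colour_inf0_inj g i x h j y k l z k' l' z' :
  (g, i) != (h, j) -> (g, i) != (k, l) -> (h, j) != (k, l) ->
  (g, i) != (k', l') -> (h, j) != (k', l') ->
  colour_inf0 g i x h j y k l z = colour_inf0 g i x h j y k' l' z' -> (k, l, z) = (k', l', z').
Proof.
move=> ij il jl il' jl' /pair_equal_spec[/addrI E]; rewrite -{k'}E in il' jl' *.
case: (eqVneq g h) ij => [<- /neq_pairb-> /edgeA_inj_h[-> ->] //| gh _].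
case: (eqVneq g k) il il' => [<- /neq_pairb-> /neq_pairb-> /edgeA_inj_g-> //|gk _ _].
case: (eqVneq h k) jl jl' => [<- /neq_pairb-> /neq_pairb-> /edgeA_inj_g-> //|hk _ _].
by move=> /generic_inj[-> ->].
Qed.

(** This separates words that agree at two common support points, whether the third points differ in
    position or only in sign. *)
Lemma triple_colour_inj P Q R R' :
  P.1 != Q.1 -> P.1 != R.1 -> Q.1 != R.1 -> P.1 != R'.1 -> Q.1 != R'.1 ->
  triple_colour P Q R = triple_colour P Q R' -> R = R'.
Proof.
have infg b z g i x (S S' : spoint) : inl b != S.1 -> inr (g, i) != S.1 ->
    inl b != S'.1 -> inr (g, i) != S'.1 ->
    triple_colour (inl b, z) (inr (g, i), x) S =
      triple_colour (inl b, z) (inr (g, i), x) S' -> S = S'.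
  case: S S' => [[b1|[h j]] y] [[b2|[h' j']] y'] /= n1 n2 n3 n4 E.
  - by have [-> ->] : (b1, y) = (b2, y') by apply: colour_inf2_inj_inf E.
  - by exfalso; apply: colour_inf2_inf1 E.
  - by exfalso; apply: colour_inf2_inf1 (esym E).
  - by have [-> -> ->] : (h, j, y) = (h', j', y') by apply: colour_inf1_inj E.
case: P Q => [[b|[g i]] z] [[b'|[g' i']] z'] n1 n2 n3 n4 n5.
- case: R R' n2 n3 n4 n5 => [[b1|[h j]] y] [[b2|[h' j']] y'] /= n2 n3 n4 n5 E;
    try by [case: b b' b1 n1 n2 n3 {n4 n5 E} => [] [] []
           |case: b b' b2 n1 n4 n5 {n2 n3 E} => [] [] []].
  by have [-> -> ->] : (h, j, y) = (h', j', y') by apply: colour_inf2_inj E.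
- exact: infg.
- by rewrite ![triple_colour (inr _, _) _ _]triple_colourC; apply: infg.
case: R R' n2 n3 n4 n5 => [[b1|[h j]] y] [[b2|[h' j']] y'] /= n2 n3 n4 n5 E.
- by have [-> ->] : (b1, y) = (b2, y') by apply: colour_inf1_inj_inf E.
- by exfalso; apply: colour_inf1_inf0 E.
- by exfalso; apply: colour_inf1_inf0 (esym E).
- by have [-> -> ->] : (h, j, y) = (h', j', y') by apply: colour_inf0_inj E.
Qed.

(** * Triples that differ by two sign changes *)

Definition flip (P : spoint) : spoint := (P.1, ~~ P.2).

Lemma colour_inf1_flip_inf b z g i x h j y : (g, i) != (h, j) ->
  colour_inf1 b z g i x h j y <> colour_inf1 b (~~ z) g i (~~ x) h j y.
Proof.
case: (eqVneq g h) => [<-|gh] ij.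
  rewrite /colour_inf1 eqxx => /pair_equal_spec[_].
  by apply: centre_flip => //; apply: neq_pair ij.
have [o|o] := boolP (orient (f (h - g)) i j b).
  by rewrite !colour_inf1_out // => /pair_equal_spec[_] /edgeB_flip3.
by rewrite !colour_inf1_in // => /pair_equal_spec[_] /edgeB_flip2.
Qed.

Lemma colour_inf1_flip b z g i x h j y : (g, i) != (h, j) ->
  colour_inf1 b z g i x h j y <> colour_inf1 b z g i (~~ x) h j (~~ y).
Proof.
case: (eqVneq g h) => [<-|gh] ij.
  rewrite /colour_inf1 eqxx ![centre (false, _) _ _ _ _ _]centreC => /pair_equal_spec[_].
  rewrite ![centre _ _ (false, _) _ _ _]centreCr.
  by apply: centre_flip => //; apply: neq_pair ij.
have [o|o] := boolP (orient (f (h - g)) i j b).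
  by rewrite !colour_inf1_out // => /pair_equal_spec[_] /edgeB_flip1.
by rewrite !colour_inf1_in // => /pair_equal_spec[_] /edgeB_flip1.
Qed.

Lemma colour_inf2_flip b z b' z' g i x : b != b' ->
  colour_inf2 b z b' z' g i x <> colour_inf2 b (~~ z) b' (~~ z') g i x.
Proof. by move=> bb' /pair_equal_spec[_]; apply: centre_flip. Qed.

Lemma colour_inf2_flip_inf b z b' z' g i x : b != b' ->
  colour_inf2 b z b' z' g i x <> colour_inf2 b (~~ z) b' z' g i (~~ x).
Proof.
move=> bb' /pair_equal_spec[_]; rewrite !(centreCr _ _ (false, b')).
exact: centre_flip.
Qed.

Lemma colour_inf0_flip g i x h j y k l z :
  (g, i) != (h, j) -> (g, i) != (k, l) -> (h, j) != (k, l) ->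
  colour_inf0 g i x h j y k l z <> colour_inf0 g i (~~ x) h j (~~ y) k l z.
Proof.
move=> ij il jl /pair_equal_spec[_].
case: (eqVneq g h) ij => [<- /neq_pairb-> /edgeA_flip1 //|gh _].
case: (eqVneq g k) => [_ /edgeA_flip2 //|gk].
case: (eqVneq h k) => [_ /edgeA_flip2 //|hk].
apply: generic_flip; rewrite /rank_lt; first exact: ltn_trans.
by move=> ltgk; case: ltnP => //= hg; apply: leq_ltn_trans ltgk.
Qed.

Lemma triple_colour_flip P Q R : P.1 != Q.1 -> P.1 != R.1 -> Q.1 != R.1 ->
  triple_colour P Q R <> triple_colour (flip P) (flip Q) R.
Proof.
case: P Q R => [[b|[g i]] x] [[b'|[g' i']] x'] [[b''|[g'' i'']] x''];
  rewrite /flip /= => n1 n2 n3.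
- by case: b b' b'' n1 n2 n3 => [] [] [].
- exact: colour_inf2_flip.
- exact: colour_inf2_flip_inf.
- exact: colour_inf1_flip_inf.
- exact: colour_inf2_flip_inf.
- exact: colour_inf1_flip_inf.
- exact: colour_inf1_flip.
- exact: colour_inf0_flip.
Qed.

End Colouring.

Arguments triple_colour : simpl never.

(** * From triples to words of weight 3 *)

Section Words.
Variables (n : nat) (G : finZmodType) (f : G -> bool) (phi : 'I_n -> gpoint G).
Local Open Scope ring_scope.
Hypothesis dbl_eq0 : forall x : G, x + x = 0 -> x = 0.
Hypothesis tpl_eq0 : forall x : G, x + x + x = 0 -> x = 0.
Hypothesis f_dbl : forall x : G, f (x + x) = f x.
Hypothesis f_opp : forall x : G, x != 0 -> f (- x) = ~~ f x.
Hypothesis phi_inj : injective phi.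
Local Close Scope ring_scope.
Implicit Types (x y : word 3 n) (a b c : 'I_n).

Definition signed x a : spoint G := (phi a, val (x a) == 2).

Definition colour x : G * F4 :=
  if [seq signed x a | a <- enum (supp x)] is [:: P; Q; R] then triple_colour f P Q R
  else (0%R, (false, false)).

Lemma supp_set3 x a b c : #|supp x| = 3 ->
  a \in supp x -> b \in supp x -> c \in supp x -> a != b -> a != c -> b != c ->
  supp x = [set a; b; c].
Proof.
move=> x3 ax bx cx ab ac bc; apply/esym/eqP; rewrite eqEcard x3; apply/andP; split.
  by apply/subsetP=> d; rewrite in_setU in_set2 in_set1 -orbA => /or3P[]/eqP->.
by rewrite setUC cardsU1 cards2 ab !inE negb_or ![c == _]eq_sym ac bc.
Qed.

(** [triple_colour] is symmetric on distinct points, so the support may be listed in any order. *)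
Lemma colourE x a b c : #|supp x| = 3 ->
  a \in supp x -> b \in supp x -> c \in supp x -> a != b -> a != c -> b != c ->
  colour x = triple_colour f (signed x a) (signed x b) (signed x c).
Proof.
move=> x3 ax bx cx ab ac bc; rewrite /colour.
have := enum_uniq (supp x); have := mem_enum (supp x).
have : size (enum (supp x)) = 3 by rewrite -cardE.
rewrite (supp_set3 x3 ax bx cx ab ac bc).
case: (enum _) => [|d1 [|d2 [|d3 []]]] //= _ E.
have := E d3; have := E d2; have := E d1; rewrite {E} !inE !eqxx ?orbT.
have D d d' : d != d' -> (signed x d).1 != (signed x d').1 by rewrite (inj_eq phi_inj).
have C1 P Q R := triple_colourC f_opp P Q R.
have C2 d d' d'' : d != d' -> d != d'' -> d' != d'' ->
   triple_colour f (signed x d) (signed x d') (signed x d'') =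
   triple_colour f (signed x d) (signed x d'') (signed x d').
  by move=> *; apply: triple_colourCr => //; apply: D.
have [ba ca cb] : [/\ b != a, c != a & c != b] by rewrite ![_ == a]eq_sym (eq_sym c b).
rewrite -!orbA.
(* Uniqueness of the enumeration leaves the six permutations of a, b, c, generated by the
   transpositions [C1] and [C2]. *)
move=> /esym/or3P[]/eqP-> /esym/or3P[]/eqP-> /esym/or3P[]/eqP->;
  rewrite ?eqxx ?orbT ?andbF //= => _.
- exact: C2.
- by rewrite C2 // C1.
- by rewrite C1 C2.
- by rewrite C1 C2 // C1.
Qed.

Lemma supp_split x c : #|supp x| = 3 -> c \in supp x ->
  exists a b, [/\ a \in supp x, b \in supp x & [/\ a != b, a != c & b != c]].
Proof.
move=> x3 cx; have /eqP/cards2P[a [b [ab E]]] : #|supp x :\ c| = 2.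
  by move: x3; rewrite (cardsD1 c) cx => -[].
exists a, b.
have : a \in supp x :\ c by rewrite E !inE eqxx.
have : b \in supp x :\ c by rewrite E !inE eqxx orbT.
by rewrite !in_setD1 => /andP[bc ->] /andP[ac ->].
Qed.

Lemma signed_eq x y a : x a = y a -> signed x a = signed y a.
Proof. by rewrite /signed => ->. Qed.

Lemma signed_neq x y a : a \in supp x -> a \in supp y -> x a != y a ->
  signed y a = flip (signed x a).
Proof.
rewrite !inE /signed /flip /=; case: (x a) (y a) => [[|[|[|?]]] ?] [[|[|[|?]]] ?] //.
Qed.

Lemma colour_proper :
  {in Hqnw 3 n 3 &, forall x y, x != y -> hdist 3 n x y <= 2 -> colour x != colour y}.
Proof.
move=> x y; rewrite !inH => /eqP x3 /eqP y3 xy dxy.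
have D d d' z z' : d != d' -> (signed z d).1 != (signed z' d').1.
  by rewrite (inj_eq phi_inj).
pose E := [set i | x i != y i]; have dE : #|E| <= 2 by [].
have inE' a : a \notin E -> x a = y a by rewrite inE negbK => /eqP.
have [Sxy|] := eqVneq (supp x) (supp y).
  have EP a : a \in E -> a \in supp x.
    apply: contraLR => ax; have ay : a \notin supp y by rewrite -Sxy.
    by move: ax ay; rewrite !inE !negbK => /eqP-> /eqP->.
  have [/eqP/cards1P[c Ec]|E1] := eqVneq #|E| 1.
    have cE : c \in E by rewrite Ec inE.
    have [a [b [ax bx [ab ac bc]]]] := supp_split x3 (EP _ cE).
    rewrite (colourE x3 ax bx (EP _ cE)) //.
    rewrite (colourE y3 (a := a) (b := b) (c := c)) -?Sxy //; do ?exact: EP.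
    have eqE d : d != c -> signed y d = signed x d.
      by move=> dc; apply/esym/signed_eq/inE'; rewrite Ec inE.
    have cxy : signed y c = flip (signed x c).
      by apply: signed_neq; rewrite -?Sxy; first [exact: EP | rewrite inE in cE].
    rewrite (eqE a) // (eqE b) // cxy; apply/eqP=> eq_col.
    have /(congr1 snd)/= : signed x c = flip (signed x c).
      by apply: (triple_colour_inj dbl_eq0 tpl_eq0 f_dbl f_opp) eq_col; apply: D.
    by case: (val _ == 2).
  have E0 : #|E| != 0.
    rewrite cards_eq0; apply: contra_neq xy => E0; apply/ffunP=> a; apply: inE'.
    by rewrite E0 inE.
  have /cards2P[a [b [ab Eab]]] : #|E| == 2 by move: dE E0 E1; case: #|E| => [|[|[|]]].
  have aE : a \in E by rewrite Eab !inE eqxx.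
  have bE : b \in E by rewrite Eab !inE eqxx orbT.
  (* The words differ at two of three support points; c is the third. *)
  have /card_gt0P[c] : 0 < #|supp x :\: E|.
    by rewrite cardsD subn_gt0 x3 (leq_ltn_trans (subset_leq_card (subsetIr _ _))).
  rewrite in_setD => /andP[cE cx].
  have ac : a != c by apply: contraNneq cE => <-.
  have bc : b != c by apply: contraNneq cE => <-.
  rewrite (colourE x3 (EP _ aE) (EP _ bE) cx) //.
  rewrite (colourE y3 (a := a) (b := b) (c := c)) -?Sxy //; do ?exact: EP.
  have flipE d : d \in E -> signed y d = flip (signed x d).
    by move=> dE'; apply: signed_neq; rewrite -?Sxy; first [exact: EP | rewrite inE in dE'].
  rewrite (flipE a) // (flipE b) // -(signed_eq (inE' _ cE)).
  by apply/eqP/triple_colour_flip; apply: D.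
move=> Sxy.
have /subsetPn[c cx cy] : ~~ (supp x \subset supp y).
  by apply: contra Sxy => sub; rewrite eqEcard sub x3 y3.
have /subsetPn[d dy dx] : ~~ (supp y \subset supp x).
  by apply: contra Sxy => sub; rewrite eq_sym eqEcard sub x3 y3.
have cd : c != d by apply: contraNneq dx => <-.
(* The points c and d use up both permitted differences, so the words agree at the other two support
   points of x. *)
have EE : E = [set c; d].
  apply/esym/eqP; rewrite eqEcard cards2 cd dE andbT; apply/subsetP=> a.
  move: cx cy dx dy; rewrite !inE !negbK => cx /eqP cy /eqP dx dy.
  by case/orP=> /eqP->; [rewrite cy | rewrite dx eq_sym].
have [a [b [ax bx [ab ac bc]]]] := supp_split x3 cx.
have ad : a != d by apply: contraNneq dx => <-.
have bd : b != d by apply: contraNneq dx => <-.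
have xya : x a = y a by apply: inE'; rewrite EE !inE negb_or ac ad.
have xyb : x b = y b by apply: inE'; rewrite EE !inE negb_or bc bd.
rewrite (colourE x3 ax bx cx) // (colourE y3 (a := a) (b := b) (c := d)) //; first last.
- by move: bx; rewrite !inE xyb.
- by move: ax; rewrite !inE xya.
rewrite -(signed_eq xya) -(signed_eq xyb).
apply/eqP=> eq_col; have /(congr1 fst)/= : signed x c = signed y d.
  by apply: (triple_colour_inj dbl_eq0 tpl_eq0 f_dbl f_opp) eq_col; apply: D.
by move=> /phi_inj/eqP; rewrite (negPf cd).
Qed.

End Words.

(** * Doubling orbits and the choice function *)

Section OddOrder.
Variables (G : finZmodType) (k : nat).
Hypothesis odd_k : odd k.
Local Open Scope ring_scope.
Hypothesis mul2k : forall x : G, x *+ 2 ^ k = x.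

Definition dbl (x : G) := x + x.

Lemma dbl_eq0 (x : G) : x + x = 0 -> x = 0.
Proof.
move=> x0; rewrite -(mul2k x); case: k odd_k => // k' _.
by rewrite expnS mulrnA mulr2n x0 mul0rn.
Qed.

(** As k is odd, 3 divides 2^k+1, and (2^k+1)x = 2x. *)
Lemma tpl_eq0 (x : G) : x + x + x = 0 -> x = 0.
Proof.
move=> x0; apply: dbl_eq0; rewrite -{2}(mul2k x) -mulrS.
have /dvdnP[q ->] : (3 %| (2 ^ k).+1)%N.
  rewrite -(odd_double_half k) odd_k add1n.
  by elim: (k./2) => // j; rewrite doubleS !(expnS 2 _.+1); lia.
by rewrite mulnC mulrnA mulrS mulr2n addrA x0 mul0rn.
Qed.

Lemma injective_dbl : injective dbl.
Proof. exact: dbl_inj dbl_eq0. Qed.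

Lemma iter_dbl i (x : G) : iter i dbl x = x *+ 2 ^ i.
Proof. by elim: i => //= i ->; rewrite /dbl -mulr2n -mulrnA expnS mulnC. Qed.

Lemma mul2k_exp i (x : G) : x *+ (2 ^ k) ^ i = x.
Proof. by elim: i => //= i IH; rewrite expnS mulrnA mul2k. Qed.

(** If 2^i x = -x, then applying 2^i k times gives -x because k is odd, but also (2^k)^i x = x;
    hence 2x = 0. *)
Lemma connect_opp (x : G) : fconnect dbl x (- x) -> x = 0.
Proof.
move=> /iter_findex; rewrite iter_dbl; move: (findex _ _ _) => i E.
apply: dbl_eq0; apply/eqP; rewrite addr_eq0 -{1}(mul2k_exp i x) expnAC; apply/eqP.
have H m : x *+ (2 ^ i) ^ m = if odd m then - x else x.
  elim: m => // m IH; rewrite expnS mulrnA E mulNrn IH /=.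
  by case: (odd m); rewrite ?opprK.
by rewrite H odd_k.
Qed.

(** This is the choice function f: of two opposite doubling orbits it selects the one whose root has
    the smaller rank. *)
Definition half_system (x : G) :=
  (enum_rank (froot dbl x) < enum_rank (froot dbl (- x)))%N.

Lemma half_system_dbl (x : G) : half_system (x + x) = half_system x.
Proof.
have r y : froot dbl (y + y) = froot dbl y.
  apply/eqP; rewrite root_connect; last exact: fconnect_sym injective_dbl.
  by rewrite (fconnect_sym injective_dbl) (fconnect1 dbl).
by rewrite /half_system opprD !r.
Qed.

Lemma half_system_opp (x : G) : x != 0 -> half_system (- x) = ~~ half_system x.
Proof.
move=> x0; rewrite /half_system opprK -leqNgt ltn_neqAle (inj_eq val_inj).
rewrite (inj_eq enum_rank_inj).
rewrite root_connect; last exact: fconnect_sym injective_dbl.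
rewrite (fconnect_sym injective_dbl).
by case: (boolP (fconnect _ _ _)) => // /connect_opp/eqP; rewrite (negPf x0).
Qed.

Lemma TOC_of_odd_order n : n = (2 * #|G| + 2)%N ->
  exists P : {set {set word 3 n}}, TOC 3 n 3 3 P.
Proof.
move=> nG.
have nE : n = #|{: gpoint G}| by rewrite nG card_sum card_prod card_bool mulnC addnC.
pose phi (i : 'I_n) : gpoint G := enum_val (cast_ord nE i).
have phi_inj : injective phi by move=> i j /enum_val_inj/cast_ord_inj.
apply: (TOC_of_colouring (c := colour half_system phi)); first by rewrite nG addnC.
  by rewrite nG addnK !card_prod card_bool mulnC -mulnA.
exact: colour_proper dbl_eq0 tpl_eq0 half_system_dbl half_system_opp phi_inj.
Qed.

End OddOrder.

(** * The groups (Z/(2^k-1))^m and the members of K *)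

Lemma TOC_mersenne k m : odd k ->
  exists P : {set {set word 3 (2 * (2 ^ k).-1 ^ m + 2)}},
    TOC 3 (2 * (2 ^ k).-1 ^ m + 2) 3 3 P.
Proof.
move=> odd_k.
(* The successor form gives ['I_g.+1] its group structure Z/(2^k-1). *)
have [g gE] : exists g, (2 ^ k).-1 = g.+1.
  case: k odd_k => // k _; exists (2 ^ k.+1 - 2).
  by have := expn_gt0 2 k; rewrite expnS; lia.
apply: (@TOC_of_odd_order 'rV['I_g.+1]_m k odd_k) => [x|]; last first.
  by rewrite card_mx card_ord mul1n gE.
have -> : 2 ^ k = (g.+1).+1 by rewrite -gE prednK // expn_gt0.
rewrite mulrS; apply/rowP=> i; rewrite !mxE mulmxnE.
suff -> : (x ord0 i *+ g.+1 = 0)%R by rewrite addr0.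
by apply: val_inj; rewrite Zp_mulrn /= modnMl.
Qed.

Theorem theorem4p4 (n : nat) :
  inK n -> exists P : {set {set word 3 n}}, TOC 3 n 3 3 P.
Proof.
case=> [[[|m] [// _ ->]] | [p [m [pK [_ ->]]]]].
  (* The length is 4^(m+1) = 2(2^(2m+1) - 1) + 2. *)
  have := @TOC_mersenne m.*2.+1 1; rewrite /= odd_double => /(_ isT).
  suff -> : 2 * (2 ^ m.*2.+1).-1 ^ 1 + 2 = 4 ^ m.+1 by [].
  have -> : 4 ^ m.+1 = 2 * 2 ^ m.*2.+1 by rewrite -expnS -doubleS -mul2n expnM.
  rewrite expn1.
  have := expn_gt0 2 m.*2.+1; lia.
(* The primes are 2^3-1, 2^5-1 and 2^7-1, with odd exponents. *)
move: pK; rewrite !inE => /or3P[]/eqP->.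
- exact: (@TOC_mersenne 3).
- exact: (@TOC_mersenne 5).
- exact: (@TOC_mersenne 7).
Qed.
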